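(* Let $n$ be a positive integer and let $K$ be a field of characteristic $p>0$. Suppose that $n\ge p$. For each $k\in\mathbb N$ let $$h_k = x_{11}x_{12}\dots x_{1k} + x_{21}x_{22}\dots x_{2k} + \dots + x_{n1}x_{n2}\dots x_{nk} \in \overline{R}_n.$$ Then, for each $k\in\mathbb N$, the polynomial $h_k$ is not contained in the $Sym(\mathbb N)$-invariant ideal of $\overline{R}_n$ generated by the set $\{h_l \mid l\in\mathbb N,\ l\ne k\}$.
   Context: Let $\mathbb N = \{1,2,\dots\}$ and let $R_n = K[x_{ij} \mid 1\le i\le n,\ j\in\mathbb N]$ be the polynomial ring over $K$ in the variables $x_{ij}$. Let $S_n = Sym(\{1,2,\dots,n\})$ and $Sym(\mathbb N)$ be the groups of all permutations of $\{1,\dots,n\}$ and of $\mathbb N$, respectively. These groups act on $R_n$ by $K$-algebra automorphisms determined by $\tau(x_{ij}) = x_{\tau(i)j}$ for $\tau\in S_n$ and $\sigma(x_{ij}) = x_{i\sigma(j)}$ for $\sigma\in Sym(\mathbb N)$. Let $\overline{R}_n = \{ f\in R_n \mid \tau(f)=f \text{ for each } \tau\in S_n\}$ be the $K$-subalgebra of symmetric polynomials; it is stable under the action of $Sym(\mathbb N)$. An ideal $I$ of $\overline{R}_n$ is called $Sym(\mathbb N)$-invariant if $\sigma(I)=I$ for all $\sigma\in Sym(\mathbb N)$. The $Sym(\mathbb N)$-invariant ideal of $\overline{R}_n$ generated by a subset $A\subseteq\overline{R}_n$ is the smallest $Sym(\mathbb N)$-invariant ideal of $\overline{R}_n$ containing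 $A$, that is, the ideal of $\overline{R}_n$ generated by $\{\sigma(a)\mid a\in A,\ \sigma\in Sym(\mathbb N)\}$. *)

(* Defs.v *)
From HB Require Import structures.
From mathcomp Require Import all_boot all_fingroup all_algebra.
From mathcomp Require Import finmap.
From mathcomp.multinomials Require Import monalg.

Set Implicit Arguments.
Unset Strict Implicit.
Unset Printing Implicit Defensive.

Import GRing.Theory.
Local Open Scope ring_scope.

(* Polynomials with coefficients in K over an arbitrary, possibly infinite,
   set V of variables: the monoid algebra of the free commutative monoid on V. *)
Section Renaming.
Variables (K : comNzRingType) (V : choiceType).

Definition pvar (v : V) : {malg K[{cmonom V}]} := << ucm v >>.

Definition rename_monom (s : V -> V) (m : {cmonom V}) : {malg K[{cmonom V}]} :=
  \prod_(v <- finsupp m) pvar (s v) ^+ m v.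

Lemma rename_monomEw (d : {fset V}) s (m : {cmonom V}) :
  (finsupp m `<=` d)%fset ->
  rename_monom s m = \prod_(v <- d) pvar (s v) ^+ m v.
Proof.
move=> le; rewrite /rename_monom; apply: big_fset_incl => // v _ vm.
by rewrite (fsfun_dflt vm) expr0.
Qed.

Lemma rename_monom_mmorphism s : mmorphism (rename_monom s).
Proof.
split=> [m1 m2|]; last by rewrite /rename_monom mdom1 big_seq_fset0.
rewrite {1}/rename_monom mdomD.
rewrite (rename_monomEw (d := (finsupp m1 `|` finsupp m2)%fset)) ?fsubsetUl //.
rewrite (rename_monomEw (d := (finsupp m1 `|` finsupp m2)%fset)) ?fsubsetUr //.
by rewrite -big_split /=; apply: eq_bigr => v _; rewrite cmM exprD.
Qed.

HB.instance Definition _ s :=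
  isMultiplicative.Build _ _ (rename_monom s) (rename_monom_mmorphism s).

(* The K-algebra endomorphism that sends each variable v to the variable s v. *)
Definition rename (s : V -> V) : {malg K[{cmonom V}]} -> {malg K[{cmonom V}]} :=
  mmap (@malgC {cmonom V} K) (rename_monom s).

HB.instance Definition _ s := GRing.RMorphism.copy (rename s)
  (mmap (@malgC {cmonom V} K) (rename_monom s)).

Lemma rename_is_scalable s : scalable (rename s).
Proof. by move=> c f; rewrite /rename mmapZ /= mul_malgC. Qed.

HB.instance Definition _ s := GRing.isScalable.Build K {malg K[{cmonom V}]}
  {malg K[{cmonom V}]} *:%R (rename s) (rename_is_scalable s).

Lemma rename_pvar s v : rename s (pvar v) = pvar (s v).
Proof.
rewrite /rename /pvar mmapU /= rmorph1 mul1r /rename_monom mdomU.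
by rewrite big_seq_fset1 cmUU expr1.
Qed.

Lemma rename_comp s t f : rename s (rename t f) = rename (s \o t) f.
Proof.
have renE u g : rename u g =
    \sum_(m <- msupp g) (g@_m)%:MP * rename_monom u m by [].
rewrite [in LHS](renE t f) (renE (s \o t) f) (raddf_sum (rename s)) /=.
apply: eq_bigr => m _; rewrite rmorphM /=; congr (_ * _).
  by rewrite /rename mmapC.
rewrite /rename_monom rmorph_prod; apply: eq_bigr => v _.
by rewrite rmorphXn /= rename_pvar.
Qed.

End Renaming.

(* Variables are indexed by pairs (i, j) with both indices counted from 0:
   (i, j) stands for the variable x_{i+1, j+1} of the usual numbering.
   Correspondingly, Sym(N) is the group of bijections nat -> nat. *)
Notation Rn n K := {malg K[{cmonom ('I_n * nat)%type}]}.

Section SymmetricPolynomials.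
Variables (n : nat) (K : comNzRingType).

Local Notation R := (Rn n K).

Definition xvar (i : 'I_n) (j : nat) : R := pvar K (i, j).

Definition row_act (tau : 'S_n) : R -> R :=
  rename (fun v : 'I_n * nat => (tau v.1, v.2)).

Definition col_act (sigma : nat -> nat) : R -> R :=
  rename (fun v : 'I_n * nat => (v.1, sigma v.2)).

HB.instance Definition _ tau := GRing.LRMorphism.copy (row_act tau)
  (rename (fun v : 'I_n * nat => (tau v.1, v.2))).
HB.instance Definition _ sigma := GRing.LRMorphism.copy (col_act sigma)
  (rename (fun v : 'I_n * nat => (v.1, sigma v.2))).

Definition symmetric_pol : {pred R} :=
  fun f => [forall tau : 'S_n, row_act tau f == f].

Lemma symmetric_polP (f : R) :
  reflect (forall tau, row_act tau f = f) (f \in symmetric_pol).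
Proof. by apply: (iffP forallP) => h tau; apply/eqP. Qed.

Lemma symmetric_pol_subalg : GRing.subalg_closed symmetric_pol.
Proof.
split=> [|c f g /symmetric_polP sf /symmetric_polP sg
         |f g /symmetric_polP sf /symmetric_polP sg];
  apply/symmetric_polP => tau.
- exact: rmorph1.
- by rewrite linearP /= sf sg.
- by rewrite rmorphM /= sf sg.
Qed.

HB.instance Definition _ :=
  GRing.isSubalgClosed.Build K R symmetric_pol symmetric_pol_subalg.

Record Rbar : Type := MkRbar { rbar_val :> R; _ : rbar_val \in symmetric_pol }.

HB.instance Definition _ := [isSub for rbar_val].
HB.instance Definition _ := [Choice of Rbar by <:].
HB.instance Definition _ := [SubChoice_isSubComNzRing of Rbar by <:].
HB.instance Definition _ := [SubZmodule_isSubLmodule of Rbar by <:].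
HB.instance Definition _ := [SubNzRing_SubLmodule_isSubLalgebra of Rbar by <:].
HB.instance Definition _ := GRing.Lalgebra_isComAlgebra.Build K Rbar.

Lemma col_act_sym sigma (f : Rbar) : col_act sigma (val f) \in symmetric_pol.
Proof.
apply/symmetric_polP => tau.
have /symmetric_polP/(_ tau) {2}<- := valP f.
by rewrite /row_act /col_act !rename_comp.
Qed.

Definition rbar_act (sigma : nat -> nat) (f : Rbar) : Rbar :=
  MkRbar (col_act_sym sigma f).

Definition is_ideal (I : Rbar -> Prop) : Prop :=
  [/\ I 0, forall f g, I f -> I g -> I (f + g) & forall a f, I f -> I (a * f)].

Definition SymN_invariant (I : Rbar -> Prop) : Prop :=
  forall sigma : nat -> nat, bijective sigma ->
  forall f, (exists2 g, I g & f = rbar_act sigma g) <-> I f.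

(* The smallest Sym(N)-invariant ideal containing A, as the intersection of all
   of them. *)
Definition SymN_ideal_gen (A : Rbar -> Prop) (f : Rbar) : Prop :=
  forall I : Rbar -> Prop, is_ideal I -> SymN_invariant I ->
  (forall a, A a -> I a) -> I f.

(* Meant for k >= 1; at k = 0 the formula gives the constant n, which is not one
   of the polynomials h_1, h_2, ... *)
Definition hpol (k : nat) : R := \sum_(i < n) \prod_(j < k) xvar i j.

Lemma hpol_sym k : hpol k \in symmetric_pol.
Proof.
apply/symmetric_polP => tau; rewrite /hpol raddf_sum.
rewrite [RHS](reindex_inj (@perm_inj _ tau)); apply: eq_bigr => i _ /=.
by rewrite rmorph_prod /=; apply: eq_bigr => j _; rewrite /row_act rename_pvar.
Qed.

Definition hbar (k : nat) : Rbar := MkRbar (hpol_sym k).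

End SymmetricPolynomials.

(* Main.v *)
Require Import Defs.
From HB Require Import structures.
From mathcomp Require Import all_boot all_fingroup all_algebra.
From mathcomp Require Import finmap.
From mathcomp.multinomials Require Import monalg.

(** Fix p rows among the n given ones, numbered by 'I_p, and a column j0 < k.
    A function phi from the first k columns to these p rows encodes the
    multilinear monomial \prod_j x_(phi j, j).  Let L f be the sum of the
    coefficients of f at the monomials of all phi with phi j0 = q0, for a fixed
    row q0.  The point is that L separates h_k from the ideal.

    On the one hand L h_k = 1: only the constant function q0 contributes.

    On the other hand L kills g * sigma(h_l) for every symmetric g, every
    injective sigma and every l <> k with 0 < l.  If sigma moves one of the
    first l columns out of range, no monomial of the product is counted.
    Otherwise let S be the image of these l columns, a nonempty proper subset
    of the k columns.  The coefficient of g * sigma(h_l) at phi vanishes unless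
    phi is constant on S, and is then a coefficient of g that depends only on
    the values of phi off S.  It is therefore unchanged when a permutation of
    the p rows is applied to the values of phi on S only; since the product is
    symmetric, it is also unchanged when the permutation is applied to all
    values of phi, hence when it is applied to the values off S only.  One of
    S and its complement, say X, avoids j0.  Prescribing the value of phi at a
    point of X then splits the sum L into p equal parts, and p = 0 in K.

    Consequently the f such that L (g * sigma f) = 0 for all symmetric g and all
    bijections sigma form an invariant ideal which contains every h_l with
    l <> k, but not h_k.

    The main steps are mcoeff_word_mulU (the coefficients of the product),
    sum_twist0 (the division into p equal parts), anchored_sum_hpol and
    anchored_sum_mul_hpol. *)

Set Implicit Arguments.
Unset Strict Implicit.
Unset Printing Implicit Defensive.

Import GRing.Theory.
Local Open Scope ring_scope.

(** * Monomials and coefficients *)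

Lemma cmonom_bigE (V : choiceType) (I : Type) (r : seq I) (P : pred I)
    (F : I -> {cmonom V}) v :
  (\big[mmul/mone]_(i <- r | P i) F i : {cmonom V}) v = (\sum_(i <- r | P i) F i v)%N.
Proof.
by apply: (big_morph (fun m : {cmonom V} => m v)) => [m1 m2|]; rewrite ?cmM ?cm1.
Qed.

Lemma malgU_big (V : choiceType) (K : comNzRingType) (I : Type) (r : seq I)
    (P : pred I) (F : I -> {cmonom V}) :
  << \big[mmul/mone]_(i <- r | P i) F i >> =
  \prod_(i <- r | P i) << F i >> :> {malg K[{cmonom V}]}.
Proof.
apply: (big_morph (fun m : {cmonom V} => << m >> : {malg K[{cmonom V}]})) => //.
by move=> m1 m2; rewrite malgM_def fgmulUU mulr1.
Qed.

Lemma malgU_inj (M : choiceType) (K : nzRingType) :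
  injective (fun m : M => << m >> : {malg K[M]}).
Proof.
move=> m1 m2 /= e; have := mcoeffUU m2 (1 : K); rewrite -e mcoeffU.
by case: eqP => // _ /esym/eqP; rewrite oner_eq0.
Qed.

Lemma malg_sumZU (M : choiceType) (K : nzRingType) (f : {malg K[M]}) :
  f = \sum_(m <- msupp f) f@_m *: << m >>.
Proof.
rewrite {1}[f]monalgE; apply: eq_bigr => m _.
by apply/malgP => m'; rewrite mcoeffZ !mcoeffU mulr_natr.
Qed.

Lemma cmonom_mulIm (V : choiceType) (m : {cmonom V}) :
  injective (fun m1 => mmul m1 m).
Proof.
move=> m1 m2 /= e; apply/eqP/cmP => v.
by have := congr1 (fun m0 : {cmonom V} => m0 v) e; rewrite /= !cmM => /addIn.
Qed.

Lemma mcoeffMU_sum (V : choiceType) (K : comNzRingType)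
    (g : {malg K[{cmonom V}]}) (m m' : {cmonom V}) :
  (g * << m >>)@_m' = \sum_(m1 <- msupp g) g@_m1 *+ (mmul m1 m == m').
Proof.
rewrite mcoeffMr msuppU1 big_seq_fset1.
by apply: eq_bigr => m1 _; rewrite mcoeffUU mulr1.
Qed.

(** The variable v witnesses that m does not divide m'. *)
Lemma mcoeffMU_ndvd (V : choiceType) (K : comNzRingType)
    (g : {malg K[{cmonom V}]}) (m m' : {cmonom V}) v :
  (m' v < m v)%N -> (g * << m >>)@_m' = 0.
Proof.
move=> lt_v; rewrite mcoeffMU_sum big1 // => m1 _; case: eqP => // e.
by move: lt_v; rewrite -e cmM ltnNge leq_addl.
Qed.

Lemma mcoeffMU (V : choiceType) (K : comNzRingType)
    (g : {malg K[{cmonom V}]}) (m m' : {cmonom V}) :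
  (g * << m >>)@_(mmul m' m) = g@_m'.
Proof.
rewrite mcoeffMU_sum (eq_bigr (fun m1 => g@_m1 *+ (m1 == m'))); last first.
  by move=> m1 _; rewrite (inj_eq (@cmonom_mulIm V m)).
rewrite {3}[g]monalgE raddf_sum /=; apply: eq_bigr => m1 _.
by rewrite mcoeffU.
Qed.

(** * Coefficients under a renaming of the variables *)

(** Written as a product of variables, not through the values of the monomial,
    so that it makes sense when s is not injective. *)
Definition push_monom (V : choiceType) (s : V -> V) (m : {cmonom V}) :
    {cmonom V} :=
  \big[mmul/mone]_(v <- finsupp m) \big[mmul/mone]_(i < m v) ucm (s v).

Lemma rename_malgU (V : choiceType) (K : comNzRingType) s (m : {cmonom V}) :
  rename s << m >> = << push_monom s m >> :> {malg K[{cmonom V}]}.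
Proof.
rewrite /rename mmapU /= rmorph1 mul1r malgU_big; apply: eq_bigr => v _.
by rewrite malgU_big prodr_const card_ord.
Qed.

Lemma push_monomE (V : choiceType) (s : V -> V) (m : {cmonom V}) v :
  injective s -> push_monom s m (s v) = m v.
Proof.
move=> inj_s; rewrite cmonom_bigE.
transitivity (\sum_(u <- finsupp m) (if u == v then m v else 0))%N.
  apply: eq_bigr => u _; rewrite cmonom_bigE sum_nat_const card_ord cmU.
  by rewrite (inj_eq inj_s); case: eqP => [->|_]; rewrite ?muln1 ?muln0.
rewrite -big_mkcond /=; case: (boolP (v \in finsupp m)) => vm.
  by rewrite big_fset_condE /= (big_fsetD1 v) ?inE ?vm ?eqxx //=
     big1_fset ?addn0 // => u; rewrite !inE => /andP[/negP ? /andP[_ ?]].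
by rewrite (fsfun_dflt vm) big1.
Qed.

Lemma push_monom_inj (V : choiceType) (s : V -> V) :
  injective s -> injective (push_monom s).
Proof.
move=> inj_s m1 m2 e; apply/eqP/cmP => v.
by rewrite -(push_monomE m1 v inj_s) e push_monomE.
Qed.

Lemma rename_sum (V : choiceType) (K : comNzRingType) s
    (f : {malg K[{cmonom V}]}) :
  rename s f = \sum_(m <- msupp f) f@_m *: << push_monom s m >>.
Proof.
rewrite {1}[f]malg_sumZU raddf_sum /=; apply: eq_bigr => m _.
by rewrite linearZ /= rename_malgU.
Qed.

Lemma rename_id (V : choiceType) (K : comNzRingType) s
    (f : {malg K[{cmonom V}]}) :
  s =1 id -> rename s f = f.
Proof.
move=> s_id; have inj_s : injective s by move=> u v; rewrite !s_id.
rewrite rename_sum [RHS]malg_sumZU; apply: eq_bigr => m _.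
suff -> : push_monom s m = m by [].
by apply/eqP/cmP => v; rewrite -{1}(s_id v) push_monomE.
Qed.

Lemma mcoeff_rename (V : choiceType) (K : comNzRingType) s
    (f : {malg K[{cmonom V}]}) m :
  injective s -> (rename s f)@_(push_monom s m) = f@_m.
Proof.
move=> inj_s; rewrite rename_sum [X in _ = X@__]malg_sumZU !raddf_sum /=.
apply: eq_bigr => m1 _; rewrite [LHS]mcoeffZ [RHS]mcoeffZ.
by rewrite [in LHS]mcoeffU [in RHS]mcoeffU (inj_eq (push_monom_inj inj_s)).
Qed.

(** * Multilinear monomials and products with a row monomial *)

(** The set D of columns is there so that the quotient of such a monomial by a row
    monomial has the same form, for the same phi. *)
Definition word_monom n k (D : {set 'I_k}) (phi : 'I_k -> 'I_n) :
    {cmonom ('I_n * nat)%type} :=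
  \big[mmul/mone]_(j in D) ucm (phi j, val j).

Lemma word_monomE n k (D : {set 'I_k}) (phi : 'I_k -> 'I_n) i (j : 'I_k) :
  word_monom D phi (i, val j) = ((j \in D) && (phi j == i)) :> nat.
Proof.
rewrite cmonom_bigE; case: (boolP (j \in D)) => jD /=.
  rewrite (bigD1 j) //= big1 ?addn0 => [|j' /andP[_ j'j]].
    by rewrite cmU xpair_eqE eqxx andbT.
  by rewrite cmU xpair_eqE (inj_eq val_inj) (negPf j'j) andbF.
rewrite big1 // => j' j'D; rewrite cmU xpair_eqE (inj_eq val_inj).
by case: (j' =P j) j'D jD => [->->|]; rewrite ?andbF.
Qed.

Lemma word_monom_out n k (D : {set 'I_k}) (phi : 'I_k -> 'I_n) i t :
  (k <= t)%N -> word_monom D phi (i, t) = 0%N.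
Proof.
move=> le_kt; rewrite cmonom_bigE big1 // => j _; rewrite cmU xpair_eqE /=.
by rewrite andbC (ltn_eqF (leq_trans (ltn_ord j) le_kt)).
Qed.

(** The row monomial divides the multilinear one exactly when phi takes the value
    i on all of S, and the quotient is then the part of phi off S. *)
Lemma mcoeff_word_mulU n (K : comNzRingType) k (S : {set 'I_k})
    (phi : 'I_k -> 'I_n) i (g : Rn n K) :
  (g * << word_monom S (fun=> i) >>)@_(word_monom setT phi) =
  if [forall j in S, phi j == i] then g@_(word_monom (~: S) phi) else 0.
Proof.
case: ifPn => [/forall_inP phiS | /forall_inPn[j jS phij]].
  rewrite -(mcoeffMU g (word_monom S (fun=> i))); congr (_ @_ _).
  rewrite {1}/word_monom (bigID (fun j => j \in S)) /= mulmC.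
  congr mmul; first by apply: eq_bigl => j; rewrite !inE.
  by apply: eq_big => [j|j /andP[_ jS]]; rewrite ?inE //; rewrite (eqP (phiS j jS)).
apply: (@mcoeffMU_ndvd _ _ _ _ _ (i, val j)).
by rewrite !word_monomE jS in_setT eqxx (negPf phij).
Qed.

(** The row permutation carries the monomial of phi to that of psi. *)
Lemma mcoeff_word_row n (K : comNzRingType) k (D : {set 'I_k})
    (phi psi : 'I_k -> 'I_n) (tau : 'S_n) (f : Rn n K) :
  f \in @symmetric_pol n K -> (forall j, psi j = tau (phi j)) ->
  f@_(word_monom D psi) = f@_(word_monom D phi).
Proof.
move=> /symmetric_polP/(_ tau) sf psiE.
set s := fun v : 'I_n * nat => (tau v.1, v.2).
have inj_s : injective s by move=> [a b] [c d] [/perm_inj -> ->].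
rewrite -(mcoeff_rename f (word_monom D phi) inj_s).
rewrite -[X in X@__ = _]sf; congr (_ @_ _).
apply: (@malgU_inj _ K); rewrite -rename_malgU !malgU_big rmorph_prod.
by apply: eq_bigr => j _; rewrite [RHS]rename_pvar /s psiE.
Qed.

(** * Twisting the rows on a set of columns *)

Definition twist k p (X : {set 'I_k}) (t : {perm 'I_p})
    (phi : {ffun 'I_k -> 'I_p}) : {ffun 'I_k -> 'I_p} :=
  [ffun j => if j \in X then t (phi j) else phi j].

(** Splitting the sum by the value of phi at j1 gives p parts, which are all equal:
    twisting by the transposition of q and q0 is a bijection between the parts
    for q and q0, and it respects the constraint at j0 because j0 is not in X. *)
Lemma sum_twist0 (K : comNzRingType) p k (X : {set 'I_k}) (j0 j1 : 'I_k)
    (q0 : 'I_p) (F : {ffun 'I_k -> 'I_p} -> K) :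
  p \in [pchar K] -> j0 \notin X -> j1 \in X ->
  (forall a b phi, F (twist X (tperm a b) phi) = F phi) ->
  \sum_(phi : {ffun 'I_k -> 'I_p} | phi j0 == q0) F phi = 0.
Proof.
move=> char_p j0X j1X Ftw.
rewrite (partition_big (fun phi : {ffun 'I_k -> 'I_p} => phi j1) predT) //=.
rewrite (eq_bigr (fun=> \sum_(phi : {ffun 'I_k -> 'I_p} |
           (phi j0 == q0) && (phi j1 == q0)) F phi)) => [|q _].
  by rewrite sumr_const card_ord -mulr_natr (pcharf0 char_p) mulr0.
have twK : involutive (twist X (tperm q q0)).
  by move=> phi; apply/ffunP => j; rewrite !ffunE; case: ifP => jX; rewrite ?jX ?tpermK.
rewrite (reindex_inj (inv_inj twK)); apply: eq_big => [phi|phi _]; last first.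
  by rewrite Ftw.
rewrite !ffunE (negPf j0X) j1X; congr (_ && _).
by rewrite (canF_eq (tpermK q q0)) tpermL.
Qed.

(** * The separating functional *)

(** Only one p-th of all the functions phi are counted: the sum over all of them
    would be p times this one on symmetric polynomials, which is zero. *)
Definition anchored_sum n (K : comNzRingType) p k (iota : 'I_p -> 'I_n)
    (j0 : 'I_k) (q0 : 'I_p) (f : Rn n K) : K :=
  \sum_(phi : {ffun 'I_k -> 'I_p} | phi j0 == q0)
    f@_(word_monom setT (iota \o phi)).

Lemma anchored_sum_is_additive n (K : comNzRingType) p k
    (iota : 'I_p -> 'I_n) (j0 : 'I_k) (q0 : 'I_p) :
  {morph @anchored_sum n K p k iota j0 q0 : f g / f - g}.
Proof.
move=> f g; rewrite /anchored_sum -sumrB; apply: eq_bigr => phi _.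
by rewrite mcoeffB.
Qed.

HB.instance Definition _ n (K : comNzRingType) p k (iota : 'I_p -> 'I_n)
    (j0 : 'I_k) (q0 : 'I_p) :=
  GRing.isZmodMorphism.Build (Rn n K) K (anchored_sum iota j0 q0)
    (anchored_sum_is_additive iota j0 q0).

Lemma col_act_hpol n (K : comNzRingType) k l (s : 'I_l -> 'I_k)
    (sigma : nat -> nat) :
  injective s -> (forall t : 'I_l, val (s t) = sigma t) ->
  col_act sigma (hpol n K l) =
  \sum_(i < n) << word_monom [set s t | t in 'I_l] (fun=> i) >>.
Proof.
move=> inj_s sE; rewrite /hpol raddf_sum; apply: eq_bigr => i _ /=.
rewrite rmorph_prod /= malgU_big big_imset /=; last by move=> ? ? _ _ /inj_s.
by apply: eq_bigr => t _; rewrite /col_act rename_pvar sE.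
Qed.

(** The coefficient of h_k at phi is 1 if phi is constant and 0 otherwise, and the
    condition at j0 leaves a single constant function. *)
Lemma anchored_sum_hpol n (K : comNzRingType) p k
    (iota : 'I_p -> 'I_n) (j0 : 'I_k) (q0 : 'I_p) :
  injective iota -> anchored_sum iota j0 q0 (hpol n K k) = 1.
Proof.
move=> inj_iota.
have hE : hpol n K k = \sum_(i < n) << word_monom [set: 'I_k] (fun=> i) >>.
  rewrite /hpol; apply: eq_bigr => i _; rewrite malgU_big.
  by apply: eq_big => [j|j _] //; rewrite !inE.
have cE (phi : {ffun 'I_k -> 'I_p}) (i : 'I_n) :
    << word_monom [set: 'I_k] (fun=> i) >>@_(word_monom setT (iota \o phi)) =
    ([forall j, iota (phi j) == i])%:R :> K.
  rewrite -[mkmalgU _ _]mul1r mcoeff_word_mulU /word_monom.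
  rewrite big_pred0 => [|j]; last by rewrite !inE.
  have -> : [forall j in [set: 'I_k], (iota \o phi) j == i] =
            [forall j, iota (phi j) == i].
    by apply: eq_forallb => j; rewrite inE.
  by rewrite mcoeff1 eqxx; case: ifP.
have hcE (phi : {ffun 'I_k -> 'I_p}) :
    (hpol n K k)@_(word_monom setT (iota \o phi)) =
    \sum_(i < n) ([forall j, iota (phi j) == i])%:R.
  by rewrite hE raddf_sum; apply: eq_bigr => i _; apply: cE.
rewrite /anchored_sum (bigD1 [ffun=> q0]) /=; last by rewrite ffunE.
rewrite hcE (bigD1 (iota q0)) //=.
have -> : [forall j : 'I_k, iota ([ffun=> q0] j) == iota q0].
  by apply/forallP => j; rewrite ffunE.
rewrite big1 => [|i i_q0]; last first.
  case: forallP => // /(_ j0); rewrite ffunE => /eqP e.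
  by rewrite -e eqxx in i_q0.
rewrite big1 ?addr0 // => phi /andP[/eqP phi_j0 phi_c].
rewrite hcE big1 // => i _; case: forallP => // all_i.
case/eqP: phi_c; apply/ffunP => j; rewrite ffunE -phi_j0; apply: inj_iota.
by rewrite (eqP (all_i j)) (eqP (all_i j0)).
Qed.

(** With S the set of columns hit by sigma, the coefficient at phi of the product
    is invariant under twists on S and under twists on its complement; the one of
    the two that avoids j0 is nonempty because 0 < l and l <> k, and sum_twist0
    applies to it. *)
Lemma anchored_sum_mul_hpol n (K : comNzRingType) p k l
    (iota : 'I_p -> 'I_n) (j0 : 'I_k) (q0 : 'I_p) (sigma : nat -> nat)
    (g : Rn n K) :
  injective iota -> p \in [pchar K] -> (0 < l)%N -> l <> k ->
  injective sigma -> g \in @symmetric_pol n K ->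
  anchored_sum iota j0 q0 (g * col_act sigma (hpol n K l)) = 0.
Proof.
move=> inj_iota char_p l_gt0 l_k inj_sigma sym_g; rewrite /anchored_sum.
case: (boolP [forall t : 'I_l, sigma t < k]%N) => [/forallP lt_k|]; last first.
  (* A column out of range occurs in every monomial of the product. *)
  case/forallPn => t; rewrite -leqNgt => le_kt; apply: big1 => phi _.
  rewrite /hpol (raddf_sum (col_act sigma)) mulr_sumr raddf_sum.
  apply: big1 => i _ /=.
  rewrite rmorph_prod /= (eq_bigr (fun u : 'I_l => << ucm (i, sigma u) >>)) =>
    [|u _]; last by rewrite /col_act rename_pvar.
  rewrite -malgU_big; apply: (@mcoeffMU_ndvd _ _ _ _ _ (i, sigma t)).
  by rewrite word_monom_out // cmonom_bigE (bigD1 t) //= cmUU.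
pose s t := Ordinal (lt_k t); pose S := [set s t | t in 'I_l].
have inj_s : injective s by move=> t u [/inj_sigma/val_inj].
have cardS : #|S| = l by rewrite card_imset // card_ord.
set f := g * _; set F := fun phi : {ffun 'I_k -> 'I_p} =>
  f@_(word_monom setT (iota \o phi)).
have sym_f : f \in @symmetric_pol n K.
  rewrite rpredM //; exact: (col_act_sym sigma (hbar n K l)).
have iota_tperm a b x :
    iota (tperm a b x) = tperm (iota a) (iota b) (iota x).
  by rewrite inj_tperm.
have F_all a b (phi psi : {ffun 'I_k -> 'I_p}) :
    (forall j, psi j = tperm a b (phi j)) -> F psi = F phi.
  move=> psiE; rewrite /F.
  refine (mcoeff_word_row (tau := tperm (iota a) (iota b)) setT sym_f _).
  by move=> j /=; rewrite psiE iota_tperm.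
have F_S a b phi : F (twist S (tperm a b) phi) = F phi.
  rewrite /F /f (col_act_hpol n K inj_s (fun=> erefl)) mulr_sumr !raddf_sum.
  (* Twisting on S turns the condition that phi takes the value i on S into
     the same condition for the transposed row, so the terms are permuted. *)
  rewrite (reindex_inj (@perm_inj _ (tperm (iota a) (iota b)))).
  apply: eq_bigr => i _ /=; rewrite !mcoeff_word_mulU -/S; congr (if _ then _ else _).
    apply: eq_forallb_in => j jS /=; rewrite ffunE jS iota_tperm.
    by rewrite (inj_eq perm_inj).
  congr (_ @_ _); apply: eq_bigr => j; rewrite inE => jS /=.
  by rewrite ffunE (negPf jS).
have F_SC a b phi : F (twist (~: S) (tperm a b) phi) = F phi.
  (* A twist off S is a twist on S followed by a global transposition. *)
  rewrite -(F_S a b phi); apply: (F_all a b) => j.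
  by rewrite !ffunE inE; case: (j \in S); rewrite ?tpermK.
case: (boolP (j0 \in S)) => j0S.
  have [j1 j1S] : exists j1, j1 \in ~: S.
    apply/set0Pn; rewrite -card_gt0 cardsCs setCK cardS card_ord subn_gt0.
    by rewrite ltn_neqAle (introN eqP l_k) -cardS -[X in (_ <= X)%N]card_ord max_card.
  by apply: (sum_twist0 (j1 := j1) q0 char_p _ j1S F_SC); rewrite inE j0S.
have [j1 j1S] : exists j1, j1 \in S by apply/set0Pn; rewrite -card_gt0 cardS.
exact: (sum_twist0 (j1 := j1) q0 char_p j0S j1S F_S).
Qed.

(** * The invariant ideal cut out by a functional *)

(** Quantifying over all symmetric g and all sigma gives the largest invariant
    ideal on which an additive L vanishes. *)
Definition kernel_ideal n (K : comNzRingType) (L : Rn n K -> K)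
    (f : Rbar n K) : Prop :=
  forall sigma, bijective sigma ->
  forall g, g \in @symmetric_pol n K -> L (g * col_act sigma (val f)) = 0.

Lemma kernel_ideal_is_ideal n (K : comNzRingType) (L : {additive Rn n K -> K}) :
  is_ideal (kernel_ideal L).
Proof.
split=> [sigma _ g _|f h If Ih sigma bij g sg|a f If sigma bij g sg].
- by rewrite /= rmorph0 mulr0 raddf0.
- rewrite (rmorphD (col_act sigma)) mulrDr raddfD.
  exact: etrans (congr2 +%R (If _ bij _ sg) (Ih _ bij _ sg)) (addr0 0).
- rewrite (rmorphM (col_act sigma)) mulrA; apply: (If _ bij).
  by rewrite rpredM //; exact: (col_act_sym sigma a).
Qed.

Lemma kernel_ideal_invariant n (K : comNzRingType) (L : Rn n K -> K) :
  SymN_invariant (kernel_ideal L).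
Proof.
move=> s0 bij0 f; split=> [[g Ig ->] sigma bij h sh|If].
  rewrite /= /col_act rename_comp; apply: (Ig (sigma \o s0)) => //.
  exact: bij_comp.
case: (bij0) => s1 s0K s1K; exists (rbar_act s1 f).
  move=> sigma bij h sh; rewrite /= /col_act rename_comp.
  by apply: (If (sigma \o s1)) => //; apply: bij_comp => //; exists s0.
apply: val_inj; rewrite /= /col_act rename_comp rename_id // => -[i j].
by rewrite /= s1K.
Qed.

(** * The theorem *)

Theorem theorem7 (n : nat) (hn : (0 < n)%N) (K : fieldType) (p : nat)
    (hK : p \in [pchar K]%R) (hnp : (p <= n)%N) (k : nat) (hk : (0 < k)%N) :
  ~ SymN_ideal_gen
      (fun f : Rbar n K => exists l : nat, [/\ (0 < l)%N, l <> k & f = hbar n K l])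
      (hbar n K k).
Proof.
have p_gt0 := prime_gt0 (pcharf_prime hK).
pose iota := widen_ord hnp.
have inj_iota : injective iota by move=> a b /(congr1 val)/= /val_inj.
pose L := @anchored_sum n K p k iota (Ordinal hk) (Ordinal p_gt0).
move=> /(_ (kernel_ideal L) (kernel_ideal_is_ideal _) (kernel_ideal_invariant _)) gen.
have h_in : kernel_ideal L (hbar n K k).
  apply: gen => _ [l [l_gt0 l_k ->]] sigma bij g sg.
  exact: (anchored_sum_mul_hpol _ _ inj_iota hK l_gt0 l_k (bij_inj bij) sg).
have bij_id : bijective (@id nat) by exists id.
have := h_in id bij_id 1 (rpred1 _).
rewrite mul1r /col_act rename_id => [|[]] //.
by rewrite [LHS]anchored_sum_hpol // => /eqP; rewrite oner_eq0.
Qed.
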